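(* Given a pMDP $M=(S,A,X,T,i)$, a parameter distribution $p \in \mathrm{Dist}(X)$, a pMDP policy $\pi_X$, and an objective function $r$, we have \[ \mathbb{E}^M_{\pi_X,i,p}(r) = \mathbb{E}^{M'}_{\pi',i'}(r') \] where $M'$ is the induced POMDP of $M$, $\pi'= \Phi(\pi_X)=\pi_X\circ f^{-1}$, $r' = r \circ f^{-1}$, and $i'(s,x)=i(s)\cdot p(x)$. Conversely, given a policy $\pi'$ of the induced POMDP $M'$ of $M$, the same equality holds for $\pi_X = \Phi^{-1}(\pi')=\pi'\circ f$.
   Context: $\mathrm{Dist}(Y)$ denotes the set of discrete probability distributions on a set $Y$, and $\delta_x$ the Dirac distribution on $x$. A pMDP $M=(S,A,X,T,i)$ has states $S$, actions $A$, parameter space $X$, transition function $T\colon S\times A\to(\mathrm{Dist}(S))^X$ and initial distribution $i\in\mathrm{Dist}(S)$. For $x\in X$, $M(x)=(S,A,T_x,i)$ is the MDP with $T_x(s,a)=T(s,a)(x)$. Runs of an MDP are infinite sequences $s_0,a_0,s_1,a_1,\dots$ with $T(s_j,a_j)(s_{j+1})>0$; histories are finite prefixes ending in a state; $\mathrm{Cone}(h)$ is the set of runs with prefix $h$. The pMDP sample space is $\mathrm{Runs}_X=\{(x,\rho)\mid x\in X,\ \rho\text{ a run of }M(x)\}$ with the $\sigma$-algebra generated by the sets $\{x\}\times\mathrm{Cone}(h)$, and $\mathrm{Hist}_X=\{(x,h)\mid h\text{ a history of }M(x)\}$. An objective is a measurable function $r\colon\mathrm{Runs}_X\to\mathbb{R}$.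 A pMDP policy is a map $\pi_X\colon \mathrm{Hist}_X\to\mathrm{Dist}(A)$ with $\pi_X(x,h)=\pi_X(y,h)$ whenever $h$ is a history of both $M(x)$ and $M(y)$; it induces MDP policies $\pi_x(h)=\pi_X(x,h)$. The measure $\mathbb{P}^{M}_{\pi_X,i,p}$ on $\mathrm{Runs}_X$ is $\mathbb{P}^M_{\pi_X,i,p}(\coprod_{x} A_x)=\sum_{x\in X}p(x)\,\mathbb{P}^{M(x)}_{\pi_x,i}(A_x)$, where $\mathbb{P}^{M(x)}_{\pi_x,i}$ is the standard measure on runs of $M(x)$ induced by policy $\pi_x$ and initial distribution $i$; $\mathbb{E}^M_{\pi_X,i,p}$ is its expectation operator. The induced POMDP of $M$ is $M'=(S\times X, A, T', S, O)$ with $T'((s,x),a)(s',x')=T(s,a)(x)(s')\cdot\delta_x(x')$, observation set $S$ and observation function $O((s,x))=s$; a POMDP policy must give the same distribution to histories with the same observation sequence, and $\mathbb{E}^{M'}_{\pi',i'}$ is the expectation w.r.t. the measure on runs of $M'$ induced by policy $\pi'$ and initial distribution $i'$. The map $f\colon\mathrm{Runs}_X\to\mathrm{Runs}(M')$, $f(x,s_0 a_0 s_1\cdots)=(s_0,x)\,a_0\,(s_1,x)\cdots$ (and analogously on histories) is an isomorphism of measurable spaces, and $\Phi(\pi_X)=\pi_X\circ f^{-1}$ is a bijection between pMDP policies of $M$ and POMDP policies of $M'$ with inverse $\Phi^{-1}(\pi')=\pi'\circ f$. *)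

(* Defs.v *)
From HB Require Import structures.
From mathcomp Require Import all_boot all_order all_algebra.
From mathcomp Require Import all_classical all_reals all_analysis.

Set Implicit Arguments.
Unset Strict Implicit.
Unset Printing Implicit Defensive.

Import Order.TTheory GRing.Theory Num.Theory.

Local Open Scope classical_set_scope.
Local Open Scope ring_scope.

(* The support of a discrete distribution on an arbitrary set is automatically
   countable, since the (unordered) sum of its weights is finite. *)
Record dist (R : realType) (Y : choiceType) := Dist {
  pmf :> Y -> R ;
  pmf_ge0 : forall y, 0 <= pmf y ;
  pmf_sum : (\esum_(y in [set: Y]) (pmf y)%:E = 1)%E }.

Section esum_lemmas.
Local Open Scope ereal_scope.
Context (R : realType).

Lemma subset_esum (I : choiceType) (B C : set I) (a : I -> \bar R) :
  (forall i, 0 <= a i) -> B `<=` C ->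
  \esum_(i in B) a i <= \esum_(i in C) a i.
Proof.
move=> a0 BC; apply: le_ereal_sup => _ [F [finF FB] <-].
by exists F => //; split => //; exact: subset_trans BC.
Qed.

Lemma esum_ge1 (I : choiceType) (B : set I) (a : I -> \bar R) i :
  (forall i, 0 <= a i) -> B i -> a i <= \esum_(i in B) a i.
Proof.
by move=> a0 Bi; rewrite -(esum_set1 (a0 i)); apply: subset_esum => // ? ->.
Qed.

Lemma ge0_esumZl (I : choiceType) (B : set I) (a : I -> \bar R) (r : R) :
  (0 <= r)%R -> (forall i, 0 <= a i) ->
  \esum_(i in B) (r%:E * a i) = r%:E * \esum_(i in B) a i.
Proof.
move=> r0 a0; rewrite /esum -ereal_supZl//; last first.
  apply/set0P; exists 0, set0; first exact: fsets_set0.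
  by rewrite fsbig_set0.
congr ereal_sup; apply/seteqP; split => [_ [F HF <-]|_ [_ [F HF <-] <-]].
  by exists (\sum_(i \in F) a i); [exists F|rewrite ge0_mule_fsumr].
by exists F => //; rewrite ge0_mule_fsumr.
Qed.

Lemma esum_disjoint (I K : choiceType) (J : I -> set K) (a : K -> \bar R) :
  (forall k, 0 <= a k) -> (forall i j k, J i k -> J j k -> i = j) ->
  \esum_(i in [set: I]) \esum_(k in J i) a k =
  \esum_(k in [set k | exists i, J i k]) a k.
Proof.
move=> a0 tJ; rewrite esum_esum//; apply/esym/reindex_esum; split => /=.
- by move=> [i k] [_ ?]; exists i.
- move=> [i1 k1] [i2 k2] /set_mem/= [_ J1] /set_mem/= [_ J2] k12.
  by subst k2; rewrite (tJ _ _ _ J1 J2).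
- by move=> k [i Jik]; exists (i, k).
Qed.

Lemma esum_bigcup_le (I : choiceType) (F : nat -> set I) (a : I -> \bar R) :
  (forall i, 0 <= a i) ->
  \esum_(i in \bigcup_n F n) a i <= \sum_(n <oo) \esum_(i in F n) a i.
Proof.
move=> a0; rewrite seqDU_bigcup_eq nneseries_sum_bigcup//.
apply: lee_nneseries => [n _ _|n _]; first exact: esum_ge0.
by apply: subset_esum => //; exact: subset_seqDU.
Qed.

Lemma dist_pos (Y : choiceType) (d : dist R Y) : exists y, (0 < d y)%R.
Proof.
apply: contrapT => /forallNP d0; have := pmf_sum d.
rewrite esum1; first by move=> /esym/eqP; rewrite onee_eq0.
move=> y _; congr EFin; apply/eqP; rewrite eq_le pmf_ge0 andbT leNgt.
exact/negP/d0.
Qed.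

End esum_lemmas.

Section paths.
Context (S A : Type).

(* The finite sequence s_0 a_0 s_1 ... a_(n-1) s_n, built from the left. *)
Inductive fseq := Start of S | Step of fseq & A & S.

Fixpoint fseq_length (h : fseq) : nat :=
  if h is Step h' _ _ then (fseq_length h').+1 else 0.

Definition fseq_last (h : fseq) : S :=
  match h with Start s => s | Step _ _ s => s end.

Fixpoint fseq_first (h : fseq) : S :=
  match h with Start s => s | Step h' _ _ => fseq_first h' end.

(* [u j] is the pair (s_j, a_j). *)
Fixpoint hprefix (u : nat -> S * A) (n : nat) : fseq :=
  if n is n'.+1 then Step (hprefix u n') (u n').2 (u n).1 else Start (u 0%N).1.

Lemma fseq_length_hprefix u n : fseq_length (hprefix u n) = n.
Proof. by elim: n => //= n ->. Qed.

Lemma fseq_last_hprefix u n : fseq_last (hprefix u n) = (u n).1.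
Proof. by case: n. Qed.

Lemma fseq_first_hprefix u n : fseq_first (hprefix u n) = (u 0%N).1.
Proof. by elim: n. Qed.

Lemma eq_hprefix u v n : (forall j, (j < n)%N -> u j = v j) ->
  (u n).1 = (v n).1 -> hprefix u n = hprefix v n.
Proof.
elim: n => [|n IHn] uv /= uvn; first by rewrite uvn.
rewrite IHn => [|j jn|]; [by rewrite (uv n)// uvn|exact: uv (ltnW jn)|].
by rewrite (uv n).
Qed.

End paths.

HB.instance Definition _ (S A : Type) := gen_eqMixin (fseq S A).
HB.instance Definition _ (S A : Type) := gen_choiceMixin (fseq S A).

Fixpoint fseq_map (S S' A : Type) (g : S -> S') (h : fseq S A) : fseq S' A :=
  match h with
  | Start s => Start A (g s)
  | Step h' a s => Step (fseq_map g h') a (g s)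
  end.

Lemma fseq_map_hprefix (S S' A : Type) (g : S -> S') (u : nat -> S * A) n :
  fseq_map g (hprefix u n) = hprefix (fun j => (g (u j).1, (u j).2)) n.
Proof. by elim: n => //= n ->. Qed.

(* Runs, histories, policies and run measures of an MDP depend on it only
   through its transition function (and an initial distribution), so they are
   defined for a transition function [T]. *)
Section runs.
Context (R : realType) (S A : pointedType) (T : S -> A -> dist R S).

Definition is_run (u : nat -> S * A) : Prop :=
  forall j, 0 < T (u j).1 (u j).2 (u j.+1).1.

Definition run := {u : nat -> S * A | is_run u}.

Definition is_history (h : fseq S A) : Prop :=
  exists (u : run) (n : nat), h = hprefix (sval u) n.

Definition history := {h : fseq S A | is_history h}.

Definition cone (h : fseq S A) : set run :=
  [set u | hprefix (sval u) (fseq_length h) = h].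

Definition cones : set (set run) := [set cone h | h in is_history].

Definition policy := history -> dist R A.

Lemma eq_run (u v : run) : sval u = sval v -> u = v.
Proof.
by case: u v => [u ru] [v rv] /= uv; subst v; rewrite (Prop_irrelevance ru rv).
Qed.

Lemma eq_history (h k : history) : sval h = sval k -> h = k.
Proof.
by case: h k => [h hh] [k hk] /= E; subst k; rewrite (Prop_irrelevance hh hk).
Qed.

Let next s := xget point [set s' | 0 < T s point s'].

Let next_gt0 s : 0 < T s point (next s).
Proof. exact: (@xgetPex _ point [set s' | 0 < T s point s'] (dist_pos _)). Qed.

Definition run_from s : run :=
  exist is_run (fun j => (iter j next s, point)) (fun j => next_gt0 (iter j next s)).

Lemma is_history_prev h a s : is_history (Step h a s) -> is_history h.
Proof. by move=> [u [[|n]]]//= [-> _ _]; exists u, n. Qed.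

Lemma is_history_start s : is_history (Start A s).
Proof. by exists (run_from s), 0%N. Qed.

Lemma is_history_step h a s : is_history h -> 0 < T (fseq_last h) a s ->
  is_history (Step h a s).
Proof.
move=> [u [n ->]]; rewrite fseq_last_hprefix => T0.
pose v j := if (j < n)%N then sval u j
  else if j == n then ((sval u n).1, a) else sval (run_from s) (j - n.+1)%N.
have v0 : is_run v.
  move=> j; rewrite /v; case: (ltngtP j n) => [jn|nj|->].
  - case: (ltngtP j.+1 n) => [_|nj|jn1]; first exact: (svalP u).
      by move: jn; rewrite ltnNge -ltnS nj.
    by have := svalP u j; rewrite jn1.
  - rewrite ltnNge (leq_trans (ltnW nj) (leqnSn j))/= gtn_eqF//; last exact: ltnW.
    rewrite (_ : j.+1 - n.+1 = (j - n.+1).+1)%N; last by rewrite -subSn.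
    exact: (svalP (run_from s)).
  - by rewrite ltnNge leqnSn/= gtn_eqF// subnn.
exists (exist _ v v0), n.+1 => /=; congr Step.
- apply: eq_hprefix => [j jn|]; first by rewrite /v jn.
  by rewrite /v ltnn eqxx.
- by rewrite /v ltnn eqxx.
- by rewrite /v ltnNge leqnSn/= gtn_eqF// subnn.
Qed.

Lemma is_history_gt0 h a s :
  is_history (Step h a s) -> 0 < T (fseq_last h) a s.
Proof.
by move=> [u [[|n]]]//= [-> -> ->]; rewrite fseq_last_hprefix; exact: (svalP u).
Qed.

End runs.

Arguments cone {R S A} T h.
Arguments cones {R S A} T.

Section fseq_prefix_order.
Context (S A : Type).
Implicit Types h k : fseq S A.

Fixpoint initial h k : Prop :=
  h = k \/ (if k is Step k' _ _ then initial h k' else False).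

Lemma initial_refl h : initial h h.
Proof. by case: h => *; left. Qed.

Lemma initial_length h k :
  initial h k -> (fseq_length h <= fseq_length k)%N.
Proof.
elim: k => [s|k IHk a s] /= [->|]//.
by move=> /IHk /leq_trans; apply.
Qed.

Lemma initial_inj h h' k : initial h k -> initial h' k ->
  fseq_length h = fseq_length h' -> h = h'.
Proof.
elim: k => [s|k IHk a s] /= [->|hk] [->|hk']//.
- by move=> E; have := initial_length hk'; rewrite -E /= ltnn.
- by move=> E; have := initial_length hk; rewrite E /= ltnn.
- exact: IHk.
Qed.

Lemma initial_child h k : initial h k ->
  h = k \/ exists q : A * S, initial (Step h q.1 q.2) k.
Proof.
elim: k => [s|k IHk a s] /= [->|]; [by left|by []|by left|].
by move=> /IHk[->|[q hq]]; right; [exists (a, s); left|exists q; right].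
Qed.

Lemma initial_prev h a s k : initial (Step h a s) k -> initial h k.
Proof.
elim: k => [t [] //|k IHk b t] /= [[<- _ _]|/IHk ?]; right => //.
exact: initial_refl.
Qed.

Lemma initial_first k : initial (Start A (fseq_first k)) k.
Proof. by elim: k => [s|k IHk a s] /=; [left|right]. Qed.

Lemma initial_hprefix (u : nat -> S * A) m n : (m <= n)%N ->
  initial (hprefix u m) (hprefix u n).
Proof.
elim: n => [|n IHn]; first by rewrite leqn0 => /eqP->; left.
rewrite leq_eqVlt => /predU1P[->|]; first exact: initial_refl.
by rewrite ltnS => /IHn ?; right.
Qed.

End fseq_prefix_order.

Section run_measure.
Context (R : realType) (S A : pointedType) (T : S -> A -> dist R S).
Context (pi : policy T) (i : dist R S).
Implicit Types h k : fseq S A.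

Definition action_weight h (a : A) : R :=
  if pselect (is_history T h) is left hh then pi (exist _ h hh) a else 0.

(* i(s_0) * prod_j pi(s_0 a_0 ... s_j)(a_j) * T(s_j, a_j)(s_(j+1)); this is 0
   when the sequence is not a history. *)
Fixpoint weight h : R :=
  match h with
  | Start s => i s
  | Step h' a s => weight h' * action_weight h' a * T (fseq_last h') a s
  end.

(* The outer measure generated by the weights of the cones. Uncountable covers
   are allowed because [A] may be uncountable, in which case the histories of
   weight 0 need not be coverable by countably many cones of weight 0. On the
   generated sigma-algebra it is the standard probability measure on runs: see
   [run_prob_cone] and [run_prob_unique] below. *)
Definition run_outer (B : set (run T)) : \bar R :=
  ereal_inf [set (\esum_(h in C) (weight h)%:E)%E |
    C in [set C : set (fseq S A) | B `<=` \bigcup_(h in C) cone T h]].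

Lemma action_weight_ge0 h a : 0 <= action_weight h a.
Proof. by rewrite /action_weight; case: pselect => // ?; exact: pmf_ge0. Qed.

Lemma weight_ge0 h : 0 <= weight h.
Proof.
elim: h => [s|h IHh a s] /=; first exact: pmf_ge0.
by rewrite !mulr_ge0// ?pmf_ge0// action_weight_ge0.
Qed.

Local Notation w h := ((weight h)%:E).

Let w_ge0 h : (0 <= w h)%E.
Proof. by rewrite lee_fin weight_ge0. Qed.

Lemma weight_nonhistory h : ~ is_history T h -> weight h = 0.
Proof.
case: h => [s /(_ (is_history_start T s))//|h a s nh /=].
have [hh|nhh] := pselect (is_history T h); last first.
  by rewrite /action_weight; case: pselect => // _; rewrite mulr0 mul0r.
have := pmf_ge0 (T (fseq_last h) a) s; rewrite le0r => /orP[/eqP->|].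
  by rewrite mulr0.
by move=> /(is_history_step hh).
Qed.

Lemma weight_sum_step h :
  (\esum_(q in [set: A * S]) w (Step h q.1 q.2) = w h)%E.
Proof.
have [hh|nhh] := pselect (is_history T h); last first.
  rewrite (weight_nonhistory nhh) esum1// => q _.
  by rewrite weight_nonhistory// => /is_history_prev.
rewrite (_ : setT = setT `*`` (fun=> setT)); last first.
  by apply/seteqP; split.
rewrite -(@esum_esum _ _ _ _ _ (fun a s => w (Step h a s)))/=; last first.
  by move=> a s _ _; exact: (w_ge0 (Step h a s)).
transitivity (\esum_(a in [set: A]) w h * (action_weight h a)%:E)%E.
  apply: eq_esum => a _.
  under eq_esum do rewrite EFinM.
  rewrite ge0_esumZl ?mulr_ge0 ?weight_ge0 ?action_weight_ge0//.
    by rewrite pmf_sum mule1.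
  by move=> ?; rewrite lee_fin pmf_ge0.
rewrite ge0_esumZl ?weight_ge0//; last first.
  by move=> a; rewrite lee_fin action_weight_ge0.
rewrite /action_weight; case: pselect => // hh'.
by rewrite pmf_sum mule1.
Qed.

Lemma le_weight_step h a s : weight (Step h a s) <= weight h.
Proof.
rewrite -lee_fin -(weight_sum_step h).
exact: (@esum_ge1 _ _ _ (fun q : A * S => w (Step h q.1 q.2)) (a, s)
  (fun q => w_ge0 _) I).
Qed.

Lemma le_weight_initial h k : initial h k -> weight k <= weight h.
Proof.
elim: k => [s|k IHk a s] /= [->|]// /IHk; apply: le_trans.
exact: (le_weight_step k a s).
Qed.

Lemma cone_step h a s : cone T (Step h a s) `<=` cone T h.
Proof. by move=> u [E _ _]; exact: E. Qed.

Lemma cone_initial h k : initial h k -> cone T k `<=` cone T h.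
Proof.
elim: k => [s|k IHk a s] /= [->|]// /IHk; apply: subset_trans.
exact: cone_step.
Qed.

Lemma cone_comparable h k u : cone T h u -> cone T k u ->
  initial h k \/ initial k h.
Proof.
rewrite /cone /= => hu ku.
have [hk|/ltnW kh] := leqP (fseq_length h) (fseq_length k).
  by left; have := initial_hprefix (sval u) hk; rewrite hu ku.
by right; have := initial_hprefix (sval u) kh; rewrite hu ku.
Qed.

Lemma run_outer_le B (C : set (fseq S A)) : B `<=` \bigcup_(h in C) cone T h ->
  (run_outer B <= \esum_(h in C) w h)%E.
Proof. by move=> BC; apply: ereal_inf_lbound; exists C. Qed.

Lemma le_run_outer B x :
  (forall C : set (fseq S A), B `<=` \bigcup_(h in C) cone T h ->
     x <= \esum_(h in C) w h)%E -> (x <= run_outer B)%E.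
Proof. by move=> H; apply: le_ereal_inf_tmp => _ [C BC <-]; exact: H. Qed.

Lemma run_outer_ge0 B : (0 <= run_outer B)%E.
Proof. by apply: le_run_outer => C _; exact: esum_ge0. Qed.

Lemma run_outer0 : run_outer set0 = 0%E.
Proof.
apply/eqP; rewrite eq_le run_outer_ge0 andbT.
by rewrite -(esum_set0 (fun h => w h)); apply: run_outer_le.
Qed.

Lemma run_outer_subset : {homo run_outer : B C / B `<=` C >-> (B <= C)%E}.
Proof.
move=> B C BC; apply: le_run_outer => D CD.
by apply: run_outer_le; exact: subset_trans CD.
Qed.

Lemma weight_sum_start : (\esum_(h in range (@Start S A)) w h = 1)%E.
Proof.
rewrite (@reindex_esum _ _ _ setT _ (@Start S A))/= ?pmf_sum//.
by split => [s _|s s' _ _ []|_ [s _ <-]]//=; [exists s|exists s].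
Qed.

Lemma cover_start B : B `<=` \bigcup_(h in range (@Start S A)) cone T h.
Proof. by move=> u _; exists (Start A (sval u 0%N).1) => //; eexists. Qed.

Lemma run_outer_le1 B : (run_outer B <= 1)%E.
Proof. by rewrite -weight_sum_start; apply: run_outer_le; exact: cover_start. Qed.

Lemma run_outer_sigma_subadditive : sigma_subadditive run_outer.
Proof.
move=> F; apply/lee_addgt0Pr => e e0.
rewrite (le_trans _ (epsilon_trick _ _ (ltW e0)))//; last first.
  by move=> n; exact: run_outer_ge0.
pose P n (C : set (fseq S A)) := F n `<=` \bigcup_(h in C) cone T h /\
  (\esum_(h in C) w h <= run_outer (F n) + (e / (2 ^ n.+1)%:R)%:E)%E.
have [G PG] : {G : nat -> set (fseq S A) & forall n, P n (G n)}.
  apply: (@choice _ _ P) => n; rewrite /P.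
  have en : 0 < e / (2 ^ n.+1)%:R by rewrite divr_gt0// ltr0n expn_gt0.
  have fin : run_outer (F n) \is a fin_num.
    by rewrite ge0_fin_numE ?run_outer_ge0// (le_lt_trans (run_outer_le1 _)) ?ltry.
  have [_ [C FC <-] /ltW leC] := lb_ereal_inf_adherent en fin.
  by exists C.
apply: (@le_trans _ _ (\esum_(h in \bigcup_n G n) w h)%E).
  apply: run_outer_le => u [n _ Fnu].
  by have [h Gh hu] := (PG n).1 _ Fnu; exists h => //; exists n.
apply: (le_trans (esum_bigcup_le _ _)) => //.
apply: lee_nneseries => [n _ _|n _]; first exact: esum_ge0.
exact: (PG n).2.
Qed.

HB.instance Definition _ := isOuterMeasure.Build R (run T) run_outer
  run_outer0 run_outer_ge0 run_outer_subset run_outer_sigma_subadditive.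

Lemma run_outer_split h (C : set (fseq S A)) X :
  X `<=` \bigcup_(k in C) cone T k ->
  (forall k, C k -> initial k h -> k = h) ->
  (run_outer (X `&` cone T h) + run_outer (X `&` ~` cone T h) <=
   \esum_(k in C) w k)%E.
Proof.
move=> XC Ch; rewrite (esumID [set k | initial h k])//.
apply: leeD; apply: run_outer_le => u [Xu].
- move=> hu; have [k Ck ku] := XC _ Xu; exists k => //; split => //=.
  have [//|kh] := cone_comparable hu ku.
  by rewrite (Ch _ Ck kh); exact: initial_refl.
- move=> hu; have [k Ck ku] := XC _ Xu; exists k => //; split => //= hk.
  exact/hu/(cone_initial hk).
Qed.

Definition children h : set (fseq S A) :=
  [set Step h q.1 q.2 | q in [set: A * S]].

Lemma weight_sum_children h : (\esum_(k in children h) w k = w h)%E.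
Proof.
rewrite -(weight_sum_step h).
rewrite (@reindex_esum _ _ _ setT _ (fun q : A * S => Step h q.1 q.2))//.
by split => [q _|[a s] [a' s'] _ _ [-> ->]|]//; exists q.
Qed.

Lemma cone_children h : cone T h `<=` \bigcup_(k in children h) cone T k.
Proof.
move=> u hu; exists (hprefix (sval u) (fseq_length h).+1).
  exists ((sval u (fseq_length h)).2, (sval u (fseq_length h).+1).1) => //=.
  by rewrite hu.
by rewrite /cone/= fseq_length_hprefix.
Qed.

Lemma cone_caratheodory h : run_outer.-caratheodory (cone T h).
Proof.
apply: le_caratheodory_measurable; elim: h => [s|h IHh a s] X.
  by apply: le_run_outer => C XC; apply: run_outer_split => // -[?|? ? ?]/= _ [].
set C0 := cone T (Step h a s).
have in_cone Y : Y `<=` cone T h ->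
    (run_outer (Y `&` C0) + run_outer (Y `&` ~` C0) <= run_outer Y)%E.
  move=> Yh; apply: le_run_outer => C YC.
  have [[k [Ck kh]]|nC] := pselect (exists k, C k /\ initial k h); last first.
    apply: run_outer_split => // k Ck /= [//|kh].
    by exfalso; apply: nC; exists k.
  apply: (@le_trans _ _ (w h)); last first.
    apply: (@le_trans _ _ (w k)); first by rewrite lee_fin le_weight_initial.
    exact: (@esum_ge1 _ _ _ (fun h => w h)).
  rewrite -(weight_sum_children h); apply: run_outer_split.
    by move=> u /Yh; exact: cone_children.
  move=> _ [q _ <-] /initial_inj; apply => //; exact: initial_refl.
have XIC : X `&` C0 = (X `&` cone T h) `&` C0.
  by rewrite -setIA (setIidr (@cone_step h a s)).
rewrite XIC; apply: le_trans (IHh X).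
apply: (le_trans _ (leeD2r _ (in_cone (X `&` cone T h) _))); last first.
  exact: subIsetr.
rewrite -addeA; apply: leeD2l.
apply: (le_trans _ (outer_measureU2 run_outer _ _)).
apply: run_outer_subset => u [Xu C0u].
by have [hu|hu] := pselect (cone T h u); [left|right].
Qed.

Lemma weight_le_cover h (C : set (fseq S A)) : is_history T h ->
  cone T h `<=` \bigcup_(k in C) cone T k -> (w h <= \esum_(k in C) w k)%E.
Proof.
move=> [v [L hE]] hC; rewrite leNgt; apply/negP => Clt.
have Lh : fseq_length h = L by rewrite hE fseq_length_hprefix.
pose m k := (\esum_(j in C `&` [set j | initial k j]) w j)%E.
pose good k := (m k < w k)%E.
have [nxt nxtP] : {nxt : fseq S A -> A * S &
    forall k, good k -> good (Step k (nxt k).1 (nxt k).2)}.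
  apply: (@choice _ _ (fun k (q : A * S) => good k -> good (Step k q.1 q.2))) => k.
  have [gk|] := pselect (good k); last by exists point.
  apply: contrapT => /forallNP ng.
  have := gk; rewrite /good ltNge => /negP; apply.
  rewrite -(weight_sum_step k).
  apply: (@le_trans _ _ (\esum_(q in [set: A * S]) m (Step k q.1 q.2))%E).
    apply: le_esum => q _; rewrite leNgt; apply/negP => gq.
    exact: (ng q).
  rewrite /m (esum_disjoint (J := fun q : A * S =>
    C `&` [set j | initial (Step k q.1 q.2) j]))//.
    apply: subset_esum => // j [q [Cj qj]].
    by split => //; exact: initial_prev qj.
  by move=> [b t] [b' t'] j [_ /= qj] [_ /= qj']; case: (initial_inj qj qj' erefl) => -> ->.
pose g n := iter n (fun k => Step k (nxt k).1 (nxt k).2) h.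
have gg n : good (g n).
  elim: n => [|n IHn]; last exact: nxtP.
  by apply: le_lt_trans Clt; apply: subset_esum => // j [].
have ghist n : is_history T (g n).
  apply: contrapT => /weight_nonhistory wg.
  have := gg n; rewrite /good wg ltNge => /negP; apply.
  by apply: esum_ge0.
pose u j := if (j < L)%N then sval v j
  else (fseq_last (g (j - L)%N), (nxt (g (j - L)%N)).1).
have uL n : u (L + n)%N = (fseq_last (g n), (nxt (g n)).1).
  by rewrite /u ltnNge leq_addr/= addKn.
have uL0 : (u L).1 = (sval v L).1.
  by rewrite -(addn0 L) uL /= hE addn0 fseq_last_hprefix.
have ru : is_run T u.
  move=> j; have [jL|/subnKC <-] := ltnP j L; last first.
    rewrite -addnS !uL /=.
    by apply: is_history_gt0; exact: (ghist (j - L).+1).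
  have uj : u j = sval v j by rewrite /u jL.
  rewrite uj; move: (jL); rewrite leq_eqVlt => /predU1P[jL1|jL1].
    by rewrite jL1 uL0 -jL1; exact: (svalP v).
  by rewrite {1}/u jL1; exact: (svalP v).
have ug n : hprefix u (L + n)%N = g n.
  elim: n => [|n IHn].
    rewrite addn0 /= hE; apply: eq_hprefix => // j jL.
    by rewrite /u jL.
  by rewrite addnS /= -addnS IHn !uL.
have [] := hC (exist _ u ru).
  by rewrite /cone /= Lh -(addn0 L) ug.
move=> k Ck; rewrite /cone /= => uk.
have wk : (w k <= \esum_(k in C) w k)%E by exact: (@esum_ge1 _ _ _ (fun k => w k)).
have [Lk|kL] := leqP L (fseq_length k).
  have kg : k = g (fseq_length k - L)%N by rewrite -ug subnKC.
  have := gg (fseq_length k - L)%N; rewrite -kg /good ltNge => /negP; apply.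
  apply: (@esum_ge1 _ _ _ (fun k => w k)) => //; split => //=.
  exact: initial_refl.
have kh : initial k h.
  have -> : h = hprefix u L by rewrite -(addn0 L) ug.
  by rewrite -uk; apply: initial_hprefix; exact: ltnW.
have := lt_le_trans (le_lt_trans wk Clt) (lexx _).
by rewrite lte_fin ltNge le_weight_initial.
Qed.

Lemma run_outer_cone h : is_history T h -> run_outer (cone T h) = w h.
Proof.
move=> hh; apply/eqP; rewrite eq_le; apply/andP; split.
  rewrite -(@esum_set1 _ _ h (fun k => w k))//.
  by apply: run_outer_le => u hu; exists h.
by apply: le_run_outer => C; exact: weight_le_cover.
Qed.

Lemma run_outerT : run_outer setT = 1%E.
Proof.
apply/eqP; rewrite eq_le run_outer_le1/=; apply: le_run_outer => C TC.
rewrite -(pmf_sum i).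
apply: (@le_trans _ _ (\esum_(s in [set: S])
    \esum_(k in C `&` [set k | initial (Start A s) k]) w k)%E).
  apply: le_esum => s _.
  apply: (@weight_le_cover (Start A s)); first exact: is_history_start.
  move=> u su; have [k Ck ku] := TC u I; exists k => //; split => //=.
  have [//|] := cone_comparable su ku.
  by case: k {Ck ku} => [t|k b t] /= [] // [->]; left.
rewrite esum_disjoint//; first by apply: subset_esum => // k [s []].
by move=> s s' k [_ /= sk] [_ /= sk']; case: (initial_inj sk sk' erefl).
Qed.

End run_measure.

Section run_space.
Context (R : realType) (S A : pointedType) (T : S -> A -> dist R S).

HB.instance Definition _ := gen_eqMixin (run T).
HB.instance Definition _ := gen_choiceMixin (run T).
HB.instance Definition _ := isPointed.Build (run T) (run_from T point).

Definition run_space := g_sigma_algebraType (cones T).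
HB.instance Definition _ := Measurable.on run_space.

Context (pi : policy T) (i : dist R S).

Definition run_prob : set run_space -> \bar R := run_outer pi i.

Lemma measurable_caratheodory (B : set run_space) : measurable B ->
  (run_outer pi i).-caratheodory B.
Proof.
apply: smallest_sub.
  split; first exact: caratheodory_measurable_set0.
    by move=> C; rewrite setTD; exact: caratheodory_measurable_setC.
  exact: caratheodory_measurable_bigcup.
by move=> _ [h hh <-]; exact: cone_caratheodory.
Qed.

Let run_prob0 : run_prob set0 = 0%E. Proof. exact: run_outer0. Qed.

Let run_prob_ge0 B : (0 <= run_prob B)%E. Proof. exact: run_outer_ge0. Qed.

Let run_prob_sigma_additive : semi_sigma_additive run_prob.
Proof.
move=> F mF tF mUF.
apply: (@caratheodory_measure_sigma_additive _ _ (run_outer pi i)) => //.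
- by move=> n; exact: measurable_caratheodory.
- exact: measurable_caratheodory.
Qed.

HB.instance Definition _ := isMeasure.Build _ _ _ run_prob
  run_prob0 run_prob_ge0 run_prob_sigma_additive.

Let run_probT : run_prob setT = 1%E. Proof. exact: run_outerT. Qed.

HB.instance Definition _ := Measure_isProbability.Build _ _ _ run_prob run_probT.

Lemma run_prob_cone h : is_history T h ->
  run_prob (cone T h) = (weight pi i h)%:E.
Proof. exact: run_outer_cone. Qed.

Lemma measurable_cone h : is_history T h -> measurable (cone T h : set run_space).
Proof. by move=> hh; apply: sub_sigma_algebra; exists h. Qed.

Lemma run_prob_unique (P : probability run_space R) :
  (forall h, is_history T h -> P (cone T h) = (weight pi i h)%:E) ->
  forall B, measurable B -> P B = run_prob B.
Proof.
move=> Pcone.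
pose G : set (set run_space) := [set B | B = set0 \/ cones T B].
have GE : measurable = <<s G >> :> set (set run_space).
  apply/seteqP; split; apply: smallest_sub => //.
  - by move=> B ?; apply: sub_sigma_algebra; right.
  - exact: (@smallest_sigma_algebra run_space setT (cones T)).
  - move=> B [->|]; [exact: sigma_algebra0|exact: sub_sigma_algebra].
have H := @g_sigma_algebra_measure_unique_trace _ R run_space G setT measurableT.
have HE : [set X | G X /\ X `<=` [set: run_space]] = G.
  by apply/seteqP; split => [X []|X].
rewrite HE in H; rewrite GE => B; apply: H => //.
- by rewrite GE; exact: sub_sigma_algebra.
- move=> C D [->|[h hh <-]]; first by rewrite set0I; left.
  move=> [->|[k hk <-]]; first by rewrite setI0; left.
  have [[u [hu ku]]|N] := pselect (exists u, (cone T h `&` cone T k) u); last first.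
    by left; apply/seteqP; split => // u hku; apply: N; exists u.
  right; have [hk'|kh] := cone_comparable hu ku.
    by exists k => //; rewrite setIidr//; exact: cone_initial.
  by exists h => //; rewrite setIidl//; exact: cone_initial.
- transitivity (1%E : \bar R); [exact: probability_setT|exact: esym run_probT].
- move=> C [->|[h hh <-]]; first by rewrite !measure0.
  by transitivity (weight pi i h)%:E; [exact: Pcone|exact/esym/run_prob_cone].
- exact: le_lt_trans (probability_le1 P measurableT) (ltry _).
Qed.

End run_space.

Section product_dist.
Context (R : realType).

Let dirac_ge0 (Y : choiceType) (x y : Y) : 0 <= (y == x)%:R :> R.
Proof. by []. Qed.

Let dirac_sum (Y : choiceType) (x : Y) :
  (\esum_(y in [set: Y]) ((y == x)%:R : R)%:E = 1)%E.
Proof.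
rewrite (esumID [set x])//.
rewrite setTI esum_set1 ?lee_fin// eqxx esum1 ?adde0//.
by move=> y [_ /eqP/negbTE ->].
Qed.

Definition dirac_dist (Y : choiceType) (x : Y) : dist R Y :=
  Dist (dirac_ge0 x) (dirac_sum x).

Context (Y Z : choiceType) (d : dist R Y) (e : dist R Z).

Let prod_ge0 (q : Y * Z) : 0 <= d q.1 * e q.2.
Proof. by rewrite mulr_ge0 ?pmf_ge0. Qed.

Let prod_sum : (\esum_(q in [set: Y * Z]) (d q.1 * e q.2)%:E = 1)%E.
Proof.
rewrite (_ : setT = setT `*`` (fun=> setT)); last by apply/seteqP; split.
rewrite -(@esum_esum _ _ _ _ _ (fun y z => (d y * e z)%:E))/=; last first.
  by move=> y z _ _; rewrite lee_fin mulr_ge0 ?pmf_ge0.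
rewrite -[RHS](pmf_sum d); apply: eq_esum => y _.
under eq_esum do rewrite EFinM.
rewrite ge0_esumZl ?pmf_ge0//; first by rewrite pmf_sum mule1.
by move=> z; rewrite lee_fin pmf_ge0.
Qed.

Definition prod_dist : dist R (Y * Z)%type := Dist prod_ge0 prod_sum.

End product_dist.

Record pMDP (R : realType) (S A X : pointedType) := MkPMDP {
  ptrans : S -> A -> X -> dist R S ;
  pinit : dist R S }.

(* The transition function T_x of the MDP M(x). *)
Definition trans_at (R : realType) (S A X : pointedType) (M : pMDP R S A X)
  (x : X) : S -> A -> dist R S := fun s a => ptrans M s a x.

Section pmdp_runs.
Context (R : realType) (S A X : pointedType) (M : pMDP R S A X).

Definition runX := {x : X & run (trans_at M x)}.
Definition historyX := {x : X & history (trans_at M x)}.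

HB.instance Definition _ := gen_eqMixin runX.
HB.instance Definition _ := gen_choiceMixin runX.
HB.instance Definition _ := isPointed.Build runX (existT _ point (point : run (trans_at M point))).

Definition conesX : set (set runX) := [set C | exists (x : X) (h : fseq S A),
  is_history (trans_at M x) h /\
  C = [set existT _ x u | u in cone (trans_at M x) h]].

Definition runX_space := g_sigma_algebraType conesX.
HB.instance Definition _ := Measurable.on runX_space.

Record pmdp_policy := PMDPPolicy {
  pmdp_policy_fun :> historyX -> dist R A ;
  pmdp_policyP : forall (x y : X) (h : fseq S A)
    (hx : is_history (trans_at M x) h) (hy : is_history (trans_at M y) h),
    pmdp_policy_fun (existT _ x (exist _ h hx)) =
    pmdp_policy_fun (existT _ y (exist _ h hy)) }.

Definition policy_at (pi : pmdp_policy) (x : X) : policy (trans_at M x) :=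
  fun h => pi (existT _ x h).
Arguments policy_at : clear implicits.

Lemma eq_runX (v w : runX) : projT1 v = projT1 w ->
  sval (projT2 v) = sval (projT2 w) -> v = w.
Proof.
by case: v w => [x u] [y v] /= xy; subst y => /eq_run ->.
Qed.

Lemma eq_historyX (v w : historyX) : projT1 v = projT1 w ->
  sval (projT2 v) = sval (projT2 w) -> v = w.
Proof.
by case: v w => [x u] [y v] /= xy; subst y => /eq_history ->.
Qed.

Context (pi : pmdp_policy) (i : dist R S) (p : dist R X).

Definition fiber (x : X) (B : set runX_space) : set (run_space (trans_at M x)) :=
  [set u | B (existT _ x u)].
Arguments fiber : clear implicits.

Definition pmdp_prob (B : set runX_space) : \bar R :=
  (\esum_(x in [set: X])
     (p x)%:E * run_prob (policy_at pi x) i (fiber x B))%E.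

Lemma measurable_fiber x (B : set runX_space) : measurable B ->
  measurable (fiber x B).
Proof.
move: B; apply: smallest_sub.
  split.
  - exact: measurable0.
  - move=> B mB; rewrite (_ : fiber x _ = ~` fiber x B); first exact: measurableC.
    by apply/seteqP; split => [u []|u].
  - move=> F mF; rewrite (_ : fiber x _ = \bigcup_n fiber x (F n)).
      exact: bigcup_measurable.
    by apply/seteqP; split => [u [n]|u [n]]; exists n.
move=> _ [y [h [hh ->]]]; have [xy|xy] := eqVneq x y.
  subst y; rewrite (_ : fiber x _ = cone (trans_at M x) h).
    exact: measurable_cone.
  apply/seteqP; split => [u [v hv E]|u hu]; last by exists u.
  by have Euv := congr1 (fun w : runX => sval (projT2 w)) E; rewrite /cone/= -Euv.
rewrite (_ : fiber x _ = set0); first exact: measurable0.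
apply/seteqP; split => // u [v hv E].
by move/eqP: xy; apply; have := congr1 (@projT1 _ _) E => /= ->.
Qed.

Let pterm_ge0 x B :
  (0 <= (p x)%:E * run_prob (policy_at pi x) i (fiber x B))%E.
Proof. by rewrite mule_ge0 ?lee_fin ?pmf_ge0. Qed.

Let pmdp_prob0 : pmdp_prob set0 = 0%E.
Proof.
rewrite /pmdp_prob esum1// => x _.
by rewrite (_ : fiber x set0 = set0)// measure0 mule0.
Qed.

Let pmdp_prob_ge0 B : (0 <= pmdp_prob B)%E.
Proof. exact: esum_ge0. Qed.

Let pmdp_prob_sigma_additive : semi_sigma_additive pmdp_prob.
Proof.
move=> F mF tF mUF.
suff -> : pmdp_prob (\bigcup_n F n) = (\sum_(n <oo) pmdp_prob (F n))%E.
  by apply: is_cvg_nneseries => n _ _.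
rewrite nneseries_esumT// /pmdp_prob.
rewrite esum_esum//.
transitivity (\esum_(x in [set: X]) \esum_(n in [set: nat])
  (p x)%:E * run_prob (policy_at pi x) i (fiber x (F n)))%E.
  apply: eq_esum => x _.
  rewrite ge0_esumZl ?pmf_ge0//; congr (_ * _)%E.
  rewrite -nneseries_esumT//.
  have mfF n : measurable (fiber x (F n)) by exact: measurable_fiber.
  have tfF : trivIset setT (fun n => fiber x (F n)).
    by move=> n m _ _ [u [un um]]; apply: (tF n m I I); exists (existT _ x u).
  have := @measure_semi_sigma_additive _ _ _ (run_prob (policy_at pi x) i)
    (fun n => fiber x (F n)) mfF tfF (bigcupT_measurable _ mfF).
  by move/cvg_lim => <-.
rewrite esum_esum// [RHS](@reindex_esum _ _ _
  (setT `*`` (fun=> setT)) _ (fun q : X * nat => (q.2, q.1)))//.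
split => [//|[? ?] [? ?] _ _ [-> ->]//|[n x] _].
by exists (x, n).
Qed.

HB.instance Definition _ := isMeasure.Build _ _ _ pmdp_prob
  pmdp_prob0 pmdp_prob_ge0 pmdp_prob_sigma_additive.

Let pmdp_probT : pmdp_prob setT = 1%E.
Proof.
rewrite -(pmf_sum p); apply: eq_esum => x _.
rewrite (_ : fiber x setT = setT)//.
by rewrite [X in (_ * X)%E](probability_setT (run_prob (policy_at pi x) i)) mule1.
Qed.

HB.instance Definition _ :=
  Measure_isProbability.Build _ _ _ pmdp_prob pmdp_probT.

End pmdp_runs.

Arguments policy_at {R S A X M} pi x.
Arguments fiber {R S A X M} x B.

Record POMDP (R : realType) (S A Z : pointedType) := MkPOMDP {
  otrans : S -> A -> dist R S ;
  obs : S -> Z }.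

(* The observation sequence O(s_0) a_0 O(s_1) ... of a history records the
   actions, which are visible to the decision maker. *)
Record pomdp_policy (R : realType) (S A Z : pointedType) (N : POMDP R S A Z) :=
  POMDPPolicy {
    pomdp_policy_fun :> policy (otrans N) ;
    pomdp_policyP : forall h k : history (otrans N),
      fseq_map (obs N) (sval h) = fseq_map (obs N) (sval k) ->
      pomdp_policy_fun h = pomdp_policy_fun k }.

Section induced.
Context (R : realType) (S A X : pointedType) (M : pMDP R S A X).

Definition induced_pomdp : POMDP R (S * X)%type A S :=
  MkPOMDP (fun sx a => prod_dist (ptrans M sx.1 a sx.2) (dirac_dist R sx.2))
          fst.

Local Notation T' := (otrans induced_pomdp).

Lemma induced_transE (s s' : S) (x x' : X) (a : A) :
  T' (s, x) a (s', x') = ptrans M s a x s' * (x' == x)%:R.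
Proof. by []. Qed.

Lemma induced_trans_gt0 q a q' : 0 < T' q a q' ->
  q'.2 = q.2 /\ 0 < trans_at M q.2 q.1 a q'.1.
Proof.
rewrite /= /trans_at; case: eqVneq => [->|_]; first by rewrite mulr1.
by rewrite mulr0 ltxx.
Qed.

Lemma run_param (u : run T') j : (sval u j).1.2 = (sval u 0%N).1.2.
Proof.
elim: j => // j <-; exact: (induced_trans_gt0 (svalP u j)).1.
Qed.

Definition add_param (x : X) (u : nat -> S * A) : nat -> (S * X) * A :=
  fun j => (((u j).1, x), (u j).2).

Definition drop_param (u : nat -> (S * X) * A) : nat -> S * A :=
  fun j => ((u j).1.1, (u j).2).

Lemma is_run_add_param (w : runX M) :
  is_run T' (add_param (projT1 w) (sval (projT2 w))).
Proof. by move=> j; rewrite /= eqxx mulr1; exact: (svalP (projT2 w) j). Qed.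

Lemma is_run_drop_param (u : run T') :
  is_run (trans_at M (sval u 0%N).1.2) (drop_param (sval u)).
Proof.
by move=> j; have := (induced_trans_gt0 (svalP u j)).2; rewrite run_param.
Qed.

Definition f_run (w : runX M) : run T' :=
  exist _ _ (is_run_add_param w).

Definition f_run_inv (u : run T') : runX M :=
  existT _ (sval u 0%N).1.2 (exist _ _ (is_run_drop_param u)).

Lemma f_runK : cancel f_run f_run_inv.
Proof.
move=> [x [u ru]]; apply: eq_runX => //=; apply/funext => j.
by rewrite /drop_param /add_param /=; case: (u j).
Qed.

Lemma f_run_invK : cancel f_run_inv f_run.
Proof.
move=> u; apply: eq_run => /=; apply/funext => j.
rewrite /drop_param /add_param /= -(run_param u j).
by case: (sval u j) => -[].
Qed.

Lemma is_history_add_param (w : historyX M) :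
  is_history T' (fseq_map (fun s => (s, projT1 w)) (sval (projT2 w))).
Proof.
case: w => x [h [u [n hE]]] /=; rewrite hE fseq_map_hprefix.
by exists (f_run (existT _ x u)), n.
Qed.

Lemma is_history_drop_param (h : history T') :
  is_history (trans_at M (fseq_first (sval h)).2) (fseq_map fst (sval h)).
Proof.
case: h => h [u [n hE]] /=; rewrite hE fseq_map_hprefix fseq_first_hprefix.
by exists (projT2 (f_run_inv u)), n.
Qed.

Definition f_history (w : historyX M) : history T' :=
  exist _ _ (is_history_add_param w).

Definition f_history_inv (h : history T') : historyX M :=
  existT _ (fseq_first (sval h)).2 (exist _ _ (is_history_drop_param h)).

Lemma f_historyK : cancel f_history f_history_inv.
Proof.
move=> [x [h hh]]; apply: eq_historyX => /=; first by elim: h {hh}.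
by elim: h {hh} => //= h -> a s.
Qed.

Lemma f_history_invK : cancel f_history_inv f_history.
Proof.
move=> [h [u [n hE]]]; apply: eq_history => /=.
rewrite hE fseq_first_hprefix !fseq_map_hprefix; congr (hprefix _ n).
apply/funext => j /=; rewrite -(run_param u j).
by case: (sval u j) => -[].
Qed.

Lemma Phi_subproof (pi : pmdp_policy M) (h k : history T') :
  fseq_map (obs induced_pomdp) (sval h) =
  fseq_map (obs induced_pomdp) (sval k) ->
  (pi \o f_history_inv) h = (pi \o f_history_inv) k.
Proof.
move=> hk /=; rewrite /f_history_inv.
move: (is_history_drop_param h) (is_history_drop_param k).
rewrite -[fseq_map _ (sval k)]hk => hh kk; exact: pmdp_policyP.
Qed.

Definition Phi (pi : pmdp_policy M) : pomdp_policy induced_pomdp :=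
  POMDPPolicy (@Phi_subproof pi).

Lemma Phi_inv_subproof (pi : pomdp_policy induced_pomdp) (x y : X)
  (h : fseq S A) (hx : is_history (trans_at M x) h)
  (hy : is_history (trans_at M y) h) :
  (pomdp_policy_fun pi \o f_history) (existT _ x (exist _ h hx)) =
  (pomdp_policy_fun pi \o f_history) (existT _ y (exist _ h hy)).
Proof.
by apply: pomdp_policyP => /=; elim: h {hx hy} => //= h -> a s.
Qed.

Definition Phi_inv (pi : pomdp_policy induced_pomdp) : pmdp_policy M :=
  PMDPPolicy (Phi_inv_subproof pi).

End induced.

(* Main.v *)
(** The map [f_run] carries the generating set [{x} * Cone(h)] of the pMDP
    sample space onto the cone of the history [f(x, h)] of the induced POMDP,
    so it is an isomorphism of measurable spaces. The weight of [f(x, h)] is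
    [p(x)] times the weight of [h] in [M(x)], because every transition of the
    induced POMDP keeps the parameter and the initial distribution is a
    product. Hence the image of the pMDP measure under [f_run] agrees with the
    run measure of the POMDP on cones, and so everywhere; the equality of
    expectations is then the change of variables along [f_run]. *)
Require Import Defs.
From HB Require Import structures.
From mathcomp Require Import all_boot all_order all_algebra.
From mathcomp Require Import all_classical all_reals all_analysis.
From mathcomp Require Import measurable_realfun.

Import Order.TTheory GRing.Theory Num.Theory.

Local Open Scope classical_set_scope.
Local Open Scope ring_scope.
Local Open Scope ereal_scope.

Section change_of_variables.
Context {d1 d2 : measure_display} {T1 : measurableType d1}
  {T2 : measurableType d2} {R : realType} (P : probability T1 R).

Lemma expectation_distribution (phi : {mfun T1 >-> T2}) (g : T2 -> R) :
  measurable_fun setT g -> 'E_(distribution P phi)[g] = 'E_P[g \o phi].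
Proof.
move=> mg; pose G y : \bar R := (g y)%:E.
have mG : measurable_fun setT G by exact/measurable_EFinP.
(* [integral_distribution] needs integrability; the positive and negative
   parts are transported separately instead. *)
rewrite unlock [LHS]integralE [RHS]integralE.
rewrite (funepos_comp G phi) (funeneg_comp G phi).
congr (_ - _); apply: ge0_integral_distribution => //.
- exact: measurable_funepos.
- exact: measurable_funeneg.
Qed.

Lemma eq_expectation_measure (Q : probability T1 R) (g : T1 -> R) :
  (forall B, measurable B -> P B = Q B) -> 'E_P[g] = 'E_Q[g].
Proof.
by move=> PQ; rewrite unlock; apply: eq_measure_integral => B mB _; exact: PQ.
Qed.

End change_of_variables.

Section fseq_map_theory.
Context {S S' A : Type}.

Lemma fseq_length_map (g : S -> S') (h : fseq S A) :
  fseq_length (fseq_map g h) = fseq_length h.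
Proof. by elim: h => //= h ->. Qed.

Lemma fseq_last_map (g : S -> S') (h : fseq S A) :
  fseq_last (fseq_map g h) = g (fseq_last h).
Proof. by case: h. Qed.

Lemma fseq_first_map (g : S -> S') (h : fseq S A) :
  fseq_first (fseq_map g h) = g (fseq_first h).
Proof. by elim: h. Qed.

Lemma fseq_mapK (g : S -> S') (g' : S' -> S) : cancel g g' ->
  cancel (@fseq_map _ _ A g) (fseq_map g').
Proof. by move=> gK; elim => [s|h IHh a s] /=; rewrite ?IHh gK. Qed.

End fseq_map_theory.

(** A sequence has at least one state, so the parameter can be read off the first one; projecting
    with [fst] recovers the rest. *)
Lemma fseq_map_pair_inj {S X A : Type} (x y : X) (h k : fseq S A) :
  fseq_map (pair^~ x) h = fseq_map (pair^~ y) k -> x = y /\ h = k.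
Proof.
move=> E; split.
  by have := congr1 (fun l => (fseq_first l).2) E; rewrite !fseq_first_map.
by have := congr1 (fseq_map fst) E; rewrite !fseq_mapK.
Qed.

Section induced_measure.
Context {R : realType} {S A X : pointedType} (M : pMDP R S A X).

Local Notation T' := (otrans (induced_pomdp M)).

Definition coneX (x : X) (h : fseq S A) : set (runX M) :=
  [set existT _ x u | u in cone (trans_at M x) h].

(** Trades an equality of dependent pairs for one of parameters, so that later proofs need no
    transport between run types. *)
Lemma coneXP x h (w : runX M) : coneX x h w <->
  projT1 w = x /\ cone (trans_at M (projT1 w)) h (projT2 w).
Proof.
split=> [[u hu <-]//|]; case: w => y u /= [yx hu].
by subst y; exists u.
Qed.

Lemma cone_f_run x h (w : runX M) :
  cone T' (fseq_map (pair^~ x) h) (f_run w) <-> coneX x h w.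
Proof.
rewrite coneXP /cone /= fseq_length_map.
have -> n : hprefix (add_param (projT1 w) (sval (projT2 w))) n =
    fseq_map (pair^~ (projT1 w)) (hprefix (sval (projT2 w)) n).
  by rewrite fseq_map_hprefix.
split=> [E|[<- ->]//]; exact: fseq_map_pair_inj E.
Qed.

Lemma preimage_f_run_cone x h :
  @f_run _ _ _ _ M @^-1` cone T' (fseq_map (pair^~ x) h) = coneX x h.
Proof. by apply/seteqP; split=> w /cone_f_run. Qed.

Lemma preimage_f_run_inv_cone x h :
  @f_run_inv _ _ _ _ M @^-1` coneX x h = cone T' (fseq_map (pair^~ x) h).
Proof.
rewrite -preimage_f_run_cone; apply/seteqP.
by split=> u; rewrite /preimage /= f_run_invK.
Qed.

Lemma is_history_pair x h :
  is_history T' (fseq_map (pair^~ x) h) <-> is_history (trans_at M x) h.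
Proof.
split=> [hh|hh]; last first.
  exact: (is_history_add_param (existT _ x (exist _ h hh))).
(* This yields a history for the parameter of the first state, which is [x] here. *)
have := is_history_drop_param (exist _ _ hh).
by rewrite /= fseq_first_map fseq_mapK.
Qed.

(** Hence every generating cone of the POMDP comes from a generator of the pMDP, and checks on cones
    reduce to constant-parameter sequences. *)
Lemma induced_historyP h : is_history T' h ->
  exists x k, is_history (trans_at M x) k /\ h = fseq_map (pair^~ x) k.
Proof.
move=> hh; have := f_history_invK (exist _ h hh).
case: f_history_inv => x [k hk] E; exists x, k; split => //.
by rewrite -[LHS](congr1 sval E).
Qed.

Lemma measurable_f_run :
  measurable_fun [set: runX_space M] (@f_run _ _ _ _ M : _ -> run_space T').
Proof.
apply: (@measurability _ _ (runX_space M) (run_space T') _ _ (cones T')) => //.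
move=> _ [_ [_ /induced_historyP[x [h [hh ->]]] <-] <-].
rewrite setTI preimage_f_run_cone.
by apply: sub_sigma_algebra; exists x, h.
Qed.

Lemma measurable_f_run_inv :
  measurable_fun [set: run_space T'] (@f_run_inv _ _ _ _ M : _ -> runX_space M).
Proof.
apply: (@measurability _ _ (run_space T') (runX_space M) _ _ (@conesX _ _ _ _ M)) => //.
move=> _ [_ [x [h [hh ->]]] <-].
rewrite setTI preimage_f_run_inv_cone.
by apply: measurable_cone; apply/is_history_pair.
Qed.

Definition f_run_mfun : {mfun runX_space M >-> run_space T'} :=
  HB.pack (@f_run _ _ _ _ M : runX_space M -> run_space T')
    (isMeasurableFun.Build _ _ _ _ _ measurable_f_run).

Context (piX : pmdp_policy M) (pi' : policy T').
(** This compatibility is all that is used of the policies, so both directions of the theorem are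
    instances of one argument. *)
Hypothesis pi'E : forall w, pi' (f_history w) = piX w.
Context (i : dist R S) (p : dist R X).

Lemma action_weight_pair x h a :
  action_weight pi' (fseq_map (pair^~ x) h) a =
  action_weight (policy_at piX x) h a.
Proof.
rewrite /action_weight; case: pselect => [hh'|nhh]; case: pselect => [hh|nhh'] //.
- by rewrite /policy_at -pi'E; congr (pi' _ a); exact: eq_history.
- by exfalso; apply/nhh'/is_history_pair.
- by exfalso; apply/nhh/is_history_pair.
Qed.

(** The factor [p x] enters once, at the initial state; each later step contributes a Dirac factor
    equal to 1. *)
Lemma weight_pair x h :
  weight pi' (prod_dist i p) (fseq_map (pair^~ x) h) =
  (p x * weight (policy_at piX x) i h)%R.
Proof.
elim: h => [s|h IHh a s] /=; first by rewrite mulrC.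
by rewrite IHh action_weight_pair fseq_last_map /= eqxx mulr1 !mulrA.
Qed.

Lemma pmdp_prob_coneX x h : is_history (trans_at M x) h ->
  pmdp_prob piX i p (coneX x h) = (p x * weight (policy_at piX x) i h)%:E.
Proof.
move=> hh.
have term_ge0 y : 0 <= (p y)%:E *
    run_prob (policy_at piX y) i (fiber y (coneX x h)).
  by apply: mule_ge0; [rewrite lee_fin Defs.pmf_ge0|exact: run_outer_ge0].
(* Only the fiber over [x] contributes, as all others are empty. *)
rewrite /pmdp_prob (esumID [set x])// setTI esum_set1//.
have -> : fiber x (coneX x h) = cone (trans_at M x) h.
  by apply/seteqP; split=> [u /coneXP[]//|u hu]; exists u.
rewrite run_prob_cone// esum1 ?adde0 ?EFinM// => y [_ yx].
rewrite (_ : fiber y _ = set0) ?measure0 ?mule0//.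
by apply/seteqP; split=> // u /coneXP[].
Qed.

Lemma distribution_f_run B : measurable B ->
  distribution (pmdp_prob piX i p) f_run_mfun B =
  run_prob pi' (prod_dist i p) B.
Proof.
apply: run_prob_unique => _ /induced_historyP[x [h [hh ->]]].
by rewrite weight_pair -(pmdp_prob_coneX _ _ hh) -preimage_f_run_cone.
Qed.

Lemma expectation_induced (r : runX_space M -> R) :
  measurable_fun [set: runX_space M] r ->
  'E_(pmdp_prob piX i p)[r] =
  'E_(run_prob pi' (prod_dist i p))[r \o f_run_inv (M := M)].
Proof.
move=> mr; rewrite -(eq_expectation_measure _ _ _ distribution_f_run).
rewrite expectation_distribution; last first.
  exact: measurableT_comp measurable_f_run_inv.
by congr expectation; apply/funext => w /=; rewrite f_runK.
Qed.

End induced_measure.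

Theorem theorem2 (R : realType) (S A X : pointedType) (M : pMDP R S A X)
    (p : dist R X) (r : runX_space M -> R)
    (mr : measurable_fun [set: runX_space M] r) :
  (forall piX : pmdp_policy M,
     'E_(pmdp_prob piX (pinit M) p)[r] =
     'E_(run_prob (Phi piX) (prod_dist (pinit M) p))[r \o f_run_inv (M := M)]) /\
  (forall pi' : pomdp_policy (induced_pomdp M),
     'E_(pmdp_prob (Phi_inv pi') (pinit M) p)[r] =
     'E_(run_prob pi' (prod_dist (pinit M) p))[r \o f_run_inv (M := M)]).
Proof.
(* For [Phi_inv] the compatibility holds by computation; for [Phi] it is the cancellation
   [f_historyK]. *)
split=> [piX|pi']; apply: expectation_induced => // w.
by rewrite /= f_historyK.
Qed.
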